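(* For every positive real number $\eta>1$, there exists a constant $c_\eta$ such that $n\le c_\eta\,\pi(n)^{\eta}$ for every $n\in\mathbb{N}$, where $\pi(n)$ is the number of prime numbers less than or equal to $n$.
   Context: The constant $c_\eta$ depends only on $\eta$.
   Formalization: The case n = 1 is excluded, because π(1) = 0 would make the inequality read 1 ≤ c_η·0 = 0, which is false for every constant; all other natural numbers, including n = 0, are covered. *)

(* Defs.v *)
(* MathComp and MathComp-Analysis; [a `^ x] ([powR]) is the real power, with
   [0 `^ x = 0] for [x != 0]. *)
From HB Require Import structures.
From mathcomp Require Import all_boot all_order all_algebra.
From mathcomp Require Import reals exp.
Set Implicit Arguments.
Unset Strict Implicit.
Unset Printing Implicit Defensive.

Definition prime_pi (n : nat) : nat := #|[set p : 'I_n.+1 | prime p]|.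

(* Main.v *)
(* The classical Chebyshev lower bound. By Legendre's formula every prime power
   dividing exactly a binomial coefficient 'C(n, k) is at most n, so 'C(n, k) is
   at most n ^ prime_pi n. Since 'C(n, n./2) is at least 2 ^ n./2, this gives
   n <= C * prime_pi n * ln n, and ln n is at most a constant times n `^ a for
   every a > 0; taking a = 1 - eta^-1 and raising to the power eta concludes. *)
Require Import Defs.
From HB Require Import structures.
From mathcomp Require Import all_boot all_order all_algebra.
From mathcomp Require Import reals exp.
From mathcomp Require Import ring.
Import Order.TTheory GRing.Theory Num.Theory.
Local Open Scope ring_scope.

(** Terms with [j > m] vanish since [p ^ j > m]. The common range lets the Legendre sums of [n], [k]
    and [n - k] be compared term by term. *)
Lemma logn_fact_widen (p m n : nat) : prime p -> (m <= n)%N ->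
  logn p m`! = (\sum_(1 <= j < n.+1) m %/ p ^ j)%N.
Proof.
move=> pp mn; rewrite logn_fact // (@big_cat_nat _ _ _ m.+1 1 n.+1) //=.
rewrite [X in (_ + X)%N]big_nat [X in (_ + X)%N]big1 ?addn0 // => j /andP[mj _].
by rewrite divn_small // (ltn_trans mj) // ltn_expl // prime_gt1.
Qed.

Lemma divn_le_split (q k n : nat) : (k <= n)%N ->
  (n %/ q <= k %/ q + (n - k) %/ q + (q <= n))%N.
Proof.
move=> kn; case: (leqP q n) => [_|nq]; last by rewrite divn_small.
by rewrite -{1}(subnKC kn) leq_divDl.
Qed.

(** By Legendre's formula each [j] contributes at most one carry, and none once [p ^ j > n], that
    is, once [j > trunc_log p n]. *)
Lemma logn_bin_le (p n k : nat) : prime p -> (k <= n)%N ->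
  (logn p 'C(n, k) <= trunc_log p n)%N.
Proof.
move=> pp kn; have p1 := prime_gt1 pp.
have [n0|n0] := posnP n.
  by move: kn; rewrite n0 leqn0 => /eqP->; rewrite bin0 logn1.
have := congr1 (logn p) (bin_fact kn).
rewrite !lognM ?muln_gt0 ?fact_gt0 ?bin_gt0 //.
rewrite !(@logn_fact_widen _ _ n) ?leq_subr // -big_split /= => e.
rewrite -(leq_add2r (\sum_(1 <= j < n.+1) (k %/ p ^ j + (n - k) %/ p ^ j))) e.
apply: (@leq_trans (\sum_(1 <= j < n.+1)
    ((k %/ p ^ j + (n - k) %/ p ^ j) + (p ^ j <= n)%N))).
  by apply: leq_sum => j _; apply: divn_le_split.
rewrite big_split /= addnC leq_add2r.
have Ln : (trunc_log p n <= n)%N.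
  by apply/ltnW/(leq_trans (ltn_expl _ p1))/trunc_logP.
rewrite (@big_cat_nat _ _ _ (trunc_log p n).+1) //=.
rewrite [X in (_ + X)%N]big_nat [X in (_ + X)%N]big1 ?addn0 => [|j /andP[Lj _]].
  apply: leq_trans (_ : \sum_(1 <= j < (trunc_log p n).+1) 1 <= _)%N.
    by apply: leq_sum => j _; apply: leq_b1.
  by rewrite sum_nat_const_nat muln1 subn1.
apply/eqP; rewrite eqb0 -ltnNge (leq_trans (trunc_log_ltn n p1)) //.
by rewrite leq_exp2l.
Qed.

Lemma bin_le_exp_prime_pi (n k : nat) : (k <= n)%N ->
  ('C(n, k) <= n ^ prime_pi n)%N.
Proof.
move=> kn; have [n0|n0] := posnP n.
  move: kn; rewrite n0 leqn0 => /eqP->.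
  (* Here [prime_pi 0 = 0], and [0 ^ 0 = 1] matches ['C(0, 0)]. *)
  by rewrite bin0 expn_gt0 /prime_pi eq_card0 // => -[[|p] //= ?]; rewrite inE.
have C0 : (0 < 'C(n, k))%N by rewrite bin_gt0.
have powle p : p \in primes 'C(n, k) -> (p ^ logn p 'C(n, k) <= n)%N.
  rewrite mem_primes => /and3P[pp _ _].
  apply: leq_trans (trunc_logP (prime_gt1 pp) n0).
  by rewrite leq_pexp2l ?prime_gt0 ?logn_bin_le.
rewrite {1}(prod_prime_decomp C0) prime_decompE big_map /=.
apply: (@leq_trans (\prod_(p <- primes 'C(n, k)) n)%N).
  by rewrite big_seq [leqRHS]big_seq; apply: leq_prod.
rewrite big_const_seq count_predT iter_muln_1 leq_pexp2l //.
(* The prime factors are distinct and each is at most [n], being bounded by its own power. *)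
rewrite /prime_pi cardE -(size_map val); apply: uniq_leq_size => [|p pC].
  exact: primes_uniq.
have pp : prime p by move: pC; rewrite mem_primes => /and3P[].
have pn : (p < n.+1)%N.
  rewrite ltnS; apply: leq_trans (powle p pC).
  by rewrite -{1}(expn1 p) leq_pexp2l ?logn_gt0 // prime_gt0.
by apply/mapP; exists (Ordinal pn) => //; rewrite mem_enum inE.
Qed.

(** Induction in steps of two: by Pascal's rule applied twice, the central coefficient at least
    doubles. *)
Lemma exp2_half_le_bin (n : nat) : (2 ^ n./2 <= 'C(n, n./2))%N.
Proof.
elim/ltn_ind: n => -[|[|n]] IH //=.
apply: (@leq_trans (2 * 'C(n, n./2))); first by rewrite expnS leq_mul2l IH.
rewrite mul2n -addnn binS; apply: leq_add; first by rewrite binS leq_addl.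
by rewrite leq_bin2l.
Qed.

Lemma ln_le_powR (R : realType) (a x : R) : 0 < a -> 0 < x ->
  ln x <= x `^ a / a.
Proof.
move=> a0 x0; rewrite ler_pdivlMr // mulrC -ln_powR.
by apply/ltW/ln_sublinear/powR_gt0.
Qed.

Lemma leq_prime_pi_ln (R : realType) (n : nat) : (1 < n)%N ->
  n%:R * ln 2 <= 3 * (prime_pi n)%:R * ln n%:R :> R.
Proof.
move=> n1; have n0 : (0 < n)%N by apply: ltnW.
have ln2 : 0 < ln 2 :> R by rewrite ln_gt0 // ltr1n.
(* The factor 3 absorbs the rounding in [n./2]; equality occurs at [n = 3]. *)
have n3 : (n <= 3 * n./2)%N.
  rewrite -{1}(odd_double_half n) mulSn mul2n leq_add2r.
  by rewrite (leq_trans (leq_b1 _)) // half_gt0.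
have H : (2 ^ n./2 <= n ^ prime_pi n)%N.
  apply/(leq_trans (exp2_half_le_bin n))/bin_le_exp_prime_pi.
  by rewrite -{2}(odd_double_half n) -addnn addnA leq_addl.
have H' : n./2%:R * ln 2 <= (prime_pi n)%:R * ln n%:R :> R.
  rewrite !mulr_natl -!lnXn ?ltr0n // ?ler_ln ?posrE ?exprn_gt0 ?ltr0n //.
  by rewrite -!natrX ler_nat.
apply: (@le_trans _ _ ((3 * n./2)%:R * ln 2)).
  by rewrite ler_pM2r // ler_nat.
by rewrite natrM -!mulrA ler_pM2l.
Qed.

(* The case n = 1 is excluded: prime_pi 1 = 0, so the inequality there would
   read 1 <= c * 0. *)
Theorem lemma4p4 (R : realType) (eta : R) (heta : 1 < eta) :
  exists c : R, forall n : nat, n <> 1%N ->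
    n%:R <= c * (prime_pi n)%:R `^ eta.
Proof.
have eta0 : 0 < eta by apply: lt_trans heta.
have a0 : 0 < 1 - eta^-1 by rewrite subr_gt0 invf_lt1.
have ln2 : 0 < ln 2 :> R by rewrite ln_gt0 // ltr1n.
set a := 1 - eta^-1 in a0.
(* The factor [3 / ln 2] comes from [leq_prime_pi_ln], and [1 / a] from [ln_le_powR]. *)
pose d := 3 / (a * ln 2).
have d0 : 0 <= d by rewrite divr_ge0 // ltW // mulr_gt0.
exists (d `^ eta) => -[|[|n]] // _; first by rewrite mulr_ge0 // powR_ge0.
set m := n.+2; have m0 : 0 < m%:R :> R by rewrite ltr0n.
(* As [eta^-1 = 1 - a], this is the Chebyshev bound, with [ln m] replaced by [m]^ a /
   a[, divided by]m [^ a]. *)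
have key : m%:R `^ eta^-1 <= d * (prime_pi m)%:R.
  have -> : m%:R `^ eta^-1 = m%:R / m%:R `^ a :> R.
    rewrite -[X in X / _]powRr1 ?ltW // -powRB ?(gt_eqF m0) ?implybT //.
    by rewrite /a opprB addrCA subrr addr0.
  rewrite ler_pdivrMr ?powR_gt0 // -(ler_pM2r ln2).
  apply: le_trans (leq_prime_pi_ln R m _) _ => //.
  apply: le_trans (_ : 3 * (prime_pi m)%:R * (m%:R `^ a / a) <= _).
    by rewrite ler_wpM2l ?mulr_ge0 // ln_le_powR.
  suff -> : d * (prime_pi m)%:R * m%:R `^ a * ln 2 =
      3 * (prime_pi m)%:R * (m%:R `^ a / a) by [].
  by rewrite /d; field; rewrite !gt_eqF.
have -> : m%:R = (m%:R `^ eta^-1) `^ eta :> R.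
  by rewrite -powRrM mulVf ?lt0r_neq0 // powRr1.
rewrite -powRM //; apply: ge0_ler_powR key; rewrite ?nnegrE ?powR_ge0 ?(mulr_ge0 d0) //.
exact: ltW.
Qed.
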